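(* Let $\alpha<\omega_1$. Then there is a block subspace $X\subseteq W$ such that one of the following holds: (1) for every block sequence $(y_n)$ in $X$ and every $K\ge1$, I has a strategy in $F^{\omega\alpha}_X$ to play $(x_0,\dots,x_k)$ satisfying $(x_0,\dots,x_k)\not\sim_K(y_0,\dots,y_k)$; (2) there is $K\ge1$ such that for every block sequence $(z_n)$ in $X$, II has a strategy in $G^\alpha_X$ to play $(x_0,\dots,x_k)$ satisfying $(x_0,\dots,x_k)\sim_K(z_0,\dots,z_k)$.
   Context: Let $\mathcal W$ be a real Banach space with Schauder basis $(e_n)$. Fix a countable subfield $\mathfrak F\subseteq\mathbb R$ such that $\|\sum_{n\le m}a_ne_n\|\in\mathfrak F$ whenever all $a_n\in\mathfrak F$, and let $W$ be the $\mathfrak F$-vector space of finite $\mathfrak F$-linear combinations of the $e_n$, with the norm of $\mathcal W$; subspaces are $\mathfrak F$-linear in $W$. For nonzero $x=\sum a_ne_n$, ${\rm supp}(x)=\{n:a_n\neq0\}$, and $x<y$ means $\max{\rm supp}(x)<\min{\rm supp}(y)$. A block sequence is a sequence of nonzero vectors $x_0<x_1<\dots$; a block subspace is the span of an infinite block sequence. $[e_i]_{i>n}$ is the span of $\{e_i:i>n\}$. $(x_i)_{i\le k}\sim_K(y_i)_{i\le k}$ means $\frac1K\|\sum a_ix_i\|\le\|\sum a_iy_i\|\le K\|\sum a_ix_i\|$ for all real $a_i$. $\omega\alpha$ is ordinal multiplication. For a countable ordinal $\gamma$: in each game, $\xi_l$ are ordinals with $\xi_0<\gamma$ and $\xi_l<\xi_{l-1}$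 for $l\ge1$, and the game ends after II's response in the round $k$ with $\xi_k=0$ (immediately with empty outcome if $\gamma=0$). Game $G^\gamma_X$: in round $l$, I plays a block subspace $Y_l\subseteq X$ and $\xi_l$; II plays a finite-dimensional $F_l\subseteq Y_l$ and a nonzero $x_l\in F_0+\dots+F_l$; outcome $(x_0,\dots,x_k)$. Game $F^\gamma_X$: in round $l$, I plays an integer $n_l$ and $\xi_l$; II plays a finite-dimensional $F_l\subseteq X\cap[e_i]_{i>n_l}$ and a nonzero $x_l\in F_0+\dots+F_l$; outcome $(x_0,\dots,x_k)$. ''A player has a strategy to play ... satisfying P'' means he can ensure the outcome satisfies P. *)

(* Defs.v *)
From HB Require Import structures.
From mathcomp Require Import all_boot all_order all_algebra.
From mathcomp Require Import all_classical all_reals all_analysis.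
Set Implicit Arguments. Unset Strict Implicit. Unset Printing Implicit Defensive.
Import Order.TTheory GRing.Theory Num.Theory.
Import numFieldNormedType.Exports.
Local Open Scope classical_set_scope.
Local Open Scope ring_scope.

(* Countable ordinals as Brouwer trees.                                 *)
(* A tree denotes: OZ = 0, OS a = a+1, OL f = sup_n f n.                *)
(* Every countable ordinal is denoted by some tree and every tree        *)
(* denotes a countable ordinal.  [ole] is exactly <= of denotations.    *)
Inductive Ord : Type :=
| OZ : Ord
| OS : Ord -> Ord
| OL : (nat -> Ord) -> Ord.

Inductive ole : Ord -> Ord -> Prop :=
| ole_zero b : ole OZ b
| ole_succ a b : ole a b -> ole (OS a) (OS b)
| ole_cocone a f k : ole a (f k) -> ole a (OL f)
| ole_limiting f b : (forall k, ole (f k) b) -> ole (OL f) b.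

Definition olt (a b : Ord) : Prop := ole (OS a) b.
Definition ozero (a : Ord) : Prop := ole a OZ.

Fixpoint oaddn (a : Ord) (n : nat) : Ord :=
  match n with O => a | S n => OS (oaddn a n) end.

(* omul_omega a denotes the ordinal product  omega * a *)
Fixpoint omul_omega (a : Ord) : Ord :=
  match a with
  | OZ => OZ
  | OS b => OL (oaddn (omul_omega b))          (* omega*b + omega *)
  | OL f => OL (fun n => omul_omega (f n))
  end.

Section Space.
Variables (R : realType) (V : normedModType R) (e : nat -> V).

Definition schauder_basis : Prop :=
  forall v : V,
    (exists a : nat -> R, (fun m => \sum_(n < m) a n *: e n) @ \oo --> v) /\
    (forall a b : nat -> R,
        (fun m => \sum_(n < m) a n *: e n) @ \oo --> v ->
        (fun m => \sum_(n < m) b n *: e n) @ \oo --> v -> a = b).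

Definition is_subfield (F : set R) : Prop :=
  F 0 /\ F 1 /\
  (forall x y, F x -> F y -> F (x + y)) /\
  (forall x, F x -> F (- x)) /\
  (forall x y, F x -> F y -> F (x * y)) /\
  (forall x, F x -> x != 0 -> F x^-1).

Definition norm_closed (F : set R) : Prop :=
  forall (m : nat) (a : nat -> R), (forall n, F (a n)) ->
    F `|\sum_(n < m.+1) a n *: e n|.

Variable F : set R.

(* A vector of W is represented by its finite list of coordinates
   s = [a_0; ...; a_m] (trailing zeros allowed), all in F.             *)
Definition inW (s : seq R) : Prop := forall i, F s`_i.

Definition vec (s : seq R) : V := \sum_(i < size s) s`_i *: e i.

Definition nonzero (s : seq R) : Prop := vec s != 0.

Definition blt (x y : seq R) : Prop :=
  forall i j, x`_i != 0 -> y`_j != 0 -> (i < j)%N.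

Definition block_seq (y : nat -> seq R) : Prop :=
  forall n, [/\ inW (y n), nonzero (y n) & blt (y n) (y n.+1)].

Definition in_fspan (gs : seq (seq R)) (x : seq R) : Prop :=
  inW x /\ exists b : nat -> R, (forall j, F (b j)) /\
    vec x = \sum_(j < size gs) b j *: vec (nth [::] gs j).

Definition in_bsub (y : nat -> seq R) (x : seq R) : Prop :=
  inW x /\ exists (m : nat) (b : nat -> R), (forall j, F (b j)) /\
    vec x = \sum_(j < m) b j *: vec (y j).

Definition bsub_incl (Y X : nat -> seq R) : Prop :=
  forall x, in_bsub Y x -> in_bsub X x.

Definition tail_after (n : int) (x : seq R) : Prop :=
  forall i : nat, (i%:Z <= n) -> x`_i = 0.

Definition equivK (K : R) (xs ys : seq (seq R)) : Prop :=
  size xs = size ys /\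
  forall a : nat -> R,
    K^-1 * `|\sum_(i < size xs) a i *: vec (nth [::] xs i)|
      <= `|\sum_(i < size ys) a i *: vec (nth [::] ys i)| /\
    `|\sum_(i < size ys) a i *: vec (nth [::] ys i)|
      <= K * `|\sum_(i < size xs) a i *: vec (nth [::] xs i)|.

(* Generic games with an ordinal clock.  A history is the list of the   *)
(* rounds played so far, each round being (move of I, move of II).      *)
Section Games.
Variables (A B : Type) (clk : A -> Ord) (outc : B -> seq R).
Variables (legalI : seq (A * B) -> A -> Prop)
          (legalII : seq (A * B) -> A -> B -> Prop).
Variable gamma : Ord.

Definition prev_clock (h : seq (A * B)) : Ord :=
  last gamma [seq clk r.1 | r <- h].
(* the game is over (after II's answer to the round with xi_k = 0,
   or immediately if gamma = 0) *)
Definition game_over (h : seq (A * B)) : Prop := ozero (prev_clock h).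
Definition outcome (h : seq (A * B)) : seq (seq R) := [seq outc r.2 | r <- h].
Definition legalI_full (h : seq (A * B)) (a : A) : Prop :=
  olt (clk a) (prev_clock h) /\ legalI h a.

Definition II_wins (P : seq (seq R) -> Prop) : Prop :=
  exists sigma : seq (A * B) -> A -> B,
  forall h : seq (A * B),
    (forall h1 r h2, h = h1 ++ r :: h2 ->
       ~ game_over h1 /\ r.2 = sigma h1 r.1 /\ legalI_full h1 r.1) ->
    (forall h1 r h2, h = h1 ++ r :: h2 -> legalII h1 r.1 r.2) /\
    (game_over h -> P (outcome h)).

Definition I_wins (P : seq (seq R) -> Prop) : Prop :=
  exists tau : seq (A * B) -> A,
  forall h : seq (A * B),
    (forall h1 r h2, h = h1 ++ r :: h2 ->
       ~ game_over h1 /\ r.1 = tau h1 /\ legalII h1 r.1 r.2) ->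
    (~ game_over h -> legalI_full h (tau h)) /\
    (game_over h -> P (outcome h)).
End Games.

Definition gens_so_far {A : Type} (h : seq (A * (seq (seq R) * seq R)))
  (Fs : seq (seq R)) : seq (seq R) :=
  flatten [seq r.2.1 | r <- h] ++ Fs.

(* Game G^gamma_X.  I: (Y_l as a block sequence, xi_l);
   II: (F_l given by a finite list of generators, x_l).               *)
Definition G_legalI (X : nat -> seq R)
  (h : seq ((nat -> seq R) * Ord * (seq (seq R) * seq R)))
  (a : (nat -> seq R) * Ord) : Prop :=
  block_seq a.1 /\ bsub_incl a.1 X.

Definition G_legalII
  (h : seq ((nat -> seq R) * Ord * (seq (seq R) * seq R)))
  (a : (nat -> seq R) * Ord) (b : seq (seq R) * seq R) : Prop :=
  (forall g, g \in b.1 -> in_bsub a.1 g) /\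
  nonzero b.2 /\ in_fspan (gens_so_far h b.1) b.2.

Definition G_game_II (X : nat -> seq R) (gamma : Ord)
  (P : seq (seq R) -> Prop) : Prop :=
  II_wins (fun a : (nat -> seq R) * Ord => a.2)
          (fun b : seq (seq R) * seq R => b.2)
          (G_legalI X) G_legalII gamma P.

Definition F_legalI
  (h : seq (int * Ord * (seq (seq R) * seq R))) (a : int * Ord) : Prop :=
  True.

Definition F_legalII (X : nat -> seq R)
  (h : seq (int * Ord * (seq (seq R) * seq R)))
  (a : int * Ord) (b : seq (seq R) * seq R) : Prop :=
  (forall g, g \in b.1 -> in_bsub X g /\ tail_after a.1 g) /\
  nonzero b.2 /\ in_fspan (gens_so_far h b.1) b.2.

Definition F_game_I (X : nat -> seq R) (gamma : Ord)
  (P : seq (seq R) -> Prop) : Prop :=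
  I_wins (fun a : int * Ord => a.2)
         (fun b : seq (seq R) * seq R => b.2)
         F_legalI (F_legalII X) gamma P.

End Space.

(* Main.v *)
(* If (1) fails for every block subspace, determinacy gives in each block subspace X a block
   sequence y and a constant K such that II wins F^{omega alpha}_X for y. As a vector of [y] is a
   combination of finitely many y_i, II then also wins the "asymptotic" game of length alpha in
   which I plays successive vectors z_l of [y] and integers n_l, and II answers with vectors x_l
   built far in X. A diagonal argument makes K uniform.
   In the "adversarial" game, II plays integers n_l, I builds his vectors far in X and plays
   subspaces Y_l, and II has to answer in the Y_l. Its positions are countable up to equivalence,
   so a fusion yields a subspace that decides each of them hereditarily; where II does not win, I
   defeats him in the asymptotic game. Hence II wins the adversarial game on some X. Composing
   the two games (z is copied to w far in X, w is copied to x in the Y_l) gives (2) for the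
   subspace [y], with constant K^2. *)
Require Import Defs.
From HB Require Import structures.
From mathcomp Require Import all_boot all_order all_algebra.
From mathcomp Require Import all_classical all_reals all_analysis.
Import Order.TTheory GRing.Theory Num.Theory.
Import numFieldNormedType.Exports.
Local Open Scope classical_set_scope.
Local Open Scope ring_scope.

(** * The order on Brouwer trees, and codes for the ordinals below a given one *)

Section Ordinals.
Set Implicit Arguments.
Unset Strict Implicit.
Unset Printing Implicit Defensive.
Implicit Types (a b c : Ord) (f : nat -> Ord).

Lemma ole_refl a : ole a a.
Proof.
elim: a => [|a IH|f IH]; first exact: ole_zero.
  exact: ole_succ.
by apply: ole_limiting => k; apply: (ole_cocone (k := k)).
Qed.

Lemma ole_OL_inv f c : ole (OL f) c -> forall k, ole (f k) c.
Proof.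
elim: c => [|c IH|g IH] H i; inversion H; subst => //.
by apply: (ole_cocone (k := k)); apply: IH.
Qed.

Lemma ole_trans b a c : ole a b -> ole b c -> ole a c.
Proof.
move=> Hab; elim: Hab c => {a b}.
- by move=> b c _; apply: ole_zero.
- move=> a b _ IH; elim=> [|c IHc|f IHf] H; inversion H; subst.
    by apply: ole_succ; apply: IH.
  by apply: (ole_cocone (k := k)); apply: IHf.
- by move=> a f k _ IH c H; apply: IH; apply: ole_OL_inv.
- by move=> f b _ IH c H; apply: ole_limiting => k; apply: IH.
Qed.

Lemma ole_OS_inv a b : ole (OS a) (OS b) -> ole a b.
Proof. by move=> H; inversion H. Qed.

Lemma olt_OL_inv a f : olt a (OL f) -> exists k, olt a (f k).
Proof. by move=> H; inversion H; subst; exists k. Qed.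

Lemma olt_OZ a : ~ olt a OZ.
Proof. by move=> H; inversion H. Qed.

Lemma ole_OS a : ole a (OS a).
Proof.
elim: a => [|a IH|f IH]; first exact: ole_zero.
  exact: ole_succ.
apply: ole_limiting => k; apply: ole_trans (IH k) _.
by apply/ole_succ/(ole_cocone (k := k))/ole_refl.
Qed.

Lemma olt_ole_trans b a c : olt a b -> ole b c -> olt a c.
Proof. exact: ole_trans. Qed.

Lemma olt_ole a b : olt a b -> ole a b.
Proof. exact: ole_trans (ole_OS a). Qed.

Lemma olt_nzero a b : olt a b -> ~ ozero b.
Proof. by move=> ab b0; apply: (@olt_OZ a); apply: ole_trans ab b0. Qed.

Lemma ole_or_olt a b : ole a b \/ olt b a.
Proof.
elim: a b => [|a IH|f IH] b; first by left; apply: ole_zero.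
  elim: b => [|b _|g IHg].
  - by right; apply/ole_succ/ole_zero.
  - by case: (IH b) => H; [left|right]; apply: ole_succ.
  (* No algorithm compares trees, so the limit cases here and below use excluded middle. *)
  - have [[k Hk]|H] := pselect (exists k, ole (OS a) (g k)).
      by left; apply: ole_cocone Hk.
    right; apply: ole_succ; apply: ole_limiting => k.
    by case: (IHg k) => Hk; [case: H; exists k|apply: ole_OS_inv].
have [H|H] := pselect (forall k, ole (f k) b).
  by left; apply: ole_limiting.
move/existsNP: H => [k Hk]; right; apply: (ole_cocone (k := k)).
by case: (IH k b).
Qed.

Lemma nzero_olt b : ~ ozero b -> olt OZ b.
Proof. by case: (ole_or_olt b OZ). Qed.

Lemma olt_wf : well_founded olt.
Proof.
(* Stated for every [b] up to [a] so that induction on the tree [a] applies: whatever is smaller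
   than [b] is bounded by the predecessor or by a branch of [a]. *)
suff H a b : ole b a -> Acc olt b by move=> a; apply: H (ole_refl a).
elim: a b => [|a IH|f IH] b ba; constructor => c cb;
  have ca := olt_ole_trans cb ba.
- by case: (olt_OZ ca).
- exact: IH (ole_OS_inv ca).
- have [k /olt_ole ck] := olt_OL_inv ca; exact: IH ck.
Qed.

Lemma oaddn_ole a b n : ole a b -> ole (oaddn a n) (oaddn b n).
Proof. by move=> ab; elim: n => //= n IH; apply: ole_succ. Qed.

Lemma omul_omega_ole a b : ole a b -> ole (omul_omega a) (omul_omega b).
Proof.
elim=> {a b} /=.
- by move=> b; apply: ole_zero.
- move=> a b _ IH; apply: ole_limiting => k.
  by apply: (ole_cocone (k := k)); apply: oaddn_ole.
- by move=> a f k _ IH; apply: ole_cocone IH.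
- by move=> f b _ IH; apply: ole_limiting.
Qed.

(** Since omega * a + n is below omega * (a + 1), each round of a game of length [b] has room for
    any finite number of rounds of the longer game. *)
Lemma omul_omega_olt a b n : olt a b ->
  ole (oaddn (omul_omega a) n) (omul_omega b).
Proof.
move=> /omul_omega_ole; apply: ole_trans => /=.
exact/(ole_cocone (k := n))/ole_refl.
Qed.

(* A code is a path in the tree: at a limit it chooses a branch, at a successor it stops when it
   is empty and goes down otherwise. Paths that run off the tree give the junk value [OZ]. *)
Fixpoint subord (a : Ord) (s : seq nat) : Ord :=
  match a, s with
  | OS a', _ :: s' => subord a' s'
  | OS a', [::] => a'
  | OL f, k :: s' => subord (f k) s'
  | _, _ => OZ
  end.

Lemma subordP a b : olt b a ->
  exists s, ole (subord a s) b /\ ole b (subord a s).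
Proof.
elim: a => [/olt_OZ|a IH|f IH] //.
  move=> /ole_OS_inv ba; have [ab|/IH[s Hs]] := ole_or_olt a b.
    by exists [::].
  (* At a successor only the emptiness of the code matters; the entry 0 is arbitrary. *)
  by exists (0%N :: s).
by move=> /olt_OL_inv[k /IH[s Hs]]; exists (k :: s).
Qed.

End Ordinals.

(** * Determinacy of games with an ordinal clock *)

Section GameDeterminacy.
Set Implicit Arguments.
Unset Strict Implicit.
Unset Printing Implicit Defensive.
Variables (R : realType) (A B : Type) (clk : A -> Ord) (outc : B -> seq R).
Variables (legalI : seq (A * B) -> A -> Prop)
          (legalII : seq (A * B) -> A -> B -> Prop).
Variables (gamma : Ord) (P : seq (seq R) -> Prop).

Local Notation game_over := (game_over clk gamma).
Local Notation legalI_full := (legalI_full clk legalI gamma).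
Local Notation outcome := (outcome outc).

(** Winning as a property of positions rather than of strategies, so that it can be built and
    inspected one round at a time; [choice] recovers a strategy. *)
Inductive II_wins_from (h : seq (A * B)) : Prop :=
| II_wins_over of game_over h & P (outcome h)
| II_wins_step of ~ game_over h & (forall a, legalI_full h a ->
    exists b, legalII h a b /\ II_wins_from (rcons h (a, b))).

Lemma prefix_rcons (Q : seq (A * B) -> A * B -> Prop) h r :
  (forall h1 r1 h2, rcons h r = h1 ++ r1 :: h2 -> Q h1 r1) ->
  (forall h1 r1 h2, h = h1 ++ r1 :: h2 -> Q h1 r1) /\ Q h r.
Proof.
move=> H; split=> [h1 r1 h2 hE|]; last by apply: (H h r [::]); rewrite cats1.
by apply: (H h1 r1 (rcons h2 r)); rewrite hE rcons_cat.
Qed.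

Lemma rcons_prefix (Q : seq (A * B) -> A * B -> Prop) h r :
  (forall h1 r1 h2, h = h1 ++ r1 :: h2 -> Q h1 r1) -> Q h r ->
  forall h1 r1 h2, rcons h r = h1 ++ r1 :: h2 -> Q h1 r1.
Proof.
move=> Hh Hr h1 r1 h2; case/lastP: h2 => [|h2 r2].
  by rewrite cats1 => /rcons_inj[<- <-].
by rewrite -rcons_cons -rcons_cat => /rcons_inj[hE _]; apply: Hh hE.
Qed.

Lemma II_wins_from_start (b0 : B) : II_wins_from [::] ->
  II_wins clk outc legalI legalII gamma P.
Proof.
move=> H0; pose good h a b := legalII h a b /\ II_wins_from (rcons h (a, b)).
(* [b0] is a default at positions without a good answer. *)
have /choice[s Hs] : forall p : seq (A * B) * A, exists b,
    (exists b', good p.1 p.2 b') -> good p.1 p.2 b.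
  move=> p; have [[b Hb]|H] := pselect (exists b', good p.1 p.2 b'); first by exists b.
  by exists b0.
exists (fun h a => s (h, a)) => h Hh.
suff [Wh Lh] : II_wins_from h /\ forall h1 r h2, h = h1 ++ r :: h2 -> legalII h1 r.1 r.2.
  by split=> // Oh; case: Wh.
elim/last_ind: h Hh => [_|h r IH].
  by split=> // -[|? ?].
move=> /(@prefix_rcons (fun h r => _)) [/IH[Wh Lh] [nO [r2 r1]]].
have [Lr Wr] : good h r.1 r.2.
  rewrite r2; apply: (Hs (h, r.1)); case: Wh => [//|_ Wh]; exact: Wh.
split; first by case: r Wr {r1 r2 Lr}.
exact: (@rcons_prefix (fun h r => legalII h r.1 r.2)).
Qed.

(** Outside [II_wins_from], I has a move after which no legal answer leads back into it, for
    otherwise [II_wins_step] would apply. When the game is over, this leaves only the failure of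
    [P]. *)
Lemma II_wins_from_determined (a0 : A) : ~ II_wins_from [::] ->
  I_wins clk outc legalI legalII gamma (fun xs => ~ P xs).
Proof.
move=> H0; pose good h a := legalI_full h a /\
  forall b, legalII h a b -> ~ II_wins_from (rcons h (a, b)).
have /choice[t Ht] : forall h, exists a, (exists a', good h a') -> good h a.
  move=> h; have [[a Ha]|H] := pselect (exists a', good h a'); first by exists a.
  by exists a0.
have Hgood h : ~ game_over h -> ~ II_wins_from h -> good h (t h).
  move=> nO nW; apply: Ht; apply: contrapT => H; apply: nW; apply: II_wins_step => // a La.
  apply: contrapT => H1; apply: H; exists a; split=> // b Lb Wb.
  by apply: H1; exists b.
exists t => h Hh.
suff nW : ~ II_wins_from h.
  split=> [nO|Oh Ph]; first by case: (Hgood h nO nW).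
  by apply: nW; apply: II_wins_over.
elim/last_ind: h Hh => [//|h r IH].
move=> /(@prefix_rcons (fun h r => _)) [/IH nW [nO [r1 Lr]]].
have [_ /(_ r.2)] := Hgood h nO nW.
by rewrite -r1 -surjective_pairing; apply.
Qed.

End GameDeterminacy.

(** * Coordinates, combinations over [F] and block subspaces *)

Section Vectors.
Set Implicit Arguments.
Unset Strict Implicit.
Unset Printing Implicit Defensive.
Variables (R : realType) (V : normedModType R) (e : nat -> V).
Hypothesis He : schauder_basis e.
Variable F : set R.
Hypothesis HF : is_subfield F.
Implicit Types (x s t : seq R) (y X Y Z : nat -> seq R).

Local Notation vec := (vec e).
Local Notation inW := (inW F).
Local Notation nonzero := (nonzero e).
Local Notation in_fspan := (in_fspan e F).
Local Notation in_bsub := (in_bsub e F).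
Local Notation block_seq := (block_seq e F).

Let F0 : F 0. Proof. by case: HF. Qed.
Let F1 : F 1. Proof. by case: HF => _ []. Qed.
Let FD a b : F a -> F b -> F (a + b).
Proof. by case: HF => _ [_] [+ _]; apply. Qed.
Let FM a b : F a -> F b -> F (a * b).
Proof. by case: HF => _ [_] [_] [_] [+ _]; apply. Qed.

Let F_sum m (f : nat -> R) : (forall j, (j < m)%N -> F (f j)) ->
  F (\sum_(j < m) f j).
Proof. by move=> Hf; elim/big_ind: _ => // i _; apply: Hf. Qed.

Lemma vec_widen N s : (size s <= N)%N -> vec s = \sum_(i < N) s`_i *: e i.
Proof.
move=> sN; rewrite /Defs.vec -!(big_mkord xpredT (fun i => s`_i *: e i)).
rewrite (big_cat_nat (n := size s) (p := N)) //= [X in _ + X]big_nat [X in _ + X]big1 ?addr0 //.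
by move=> i /andP[si _]; rewrite nth_default // scale0r.
Qed.

(** Padding [a] with zeros gives an expansion of 0, and uniqueness of expansions identifies it with
    the null one. *)
Lemma basis_free N (a : nat -> R) : \sum_(i < N) a i *: e i = 0 ->
  forall i, (i < N)%N -> a i = 0.
Proof.
move=> aN i iN; have [_ Huniq] := He 0.
pose a' j := if (j < N)%N then a j else 0.
have a'0 : (fun m => \sum_(n < m) a' n *: e n) @ \oo --> 0.
  apply: cvg_near_cst; near=> m.
  have Nm : (N <= m)%N by near: m; exists N.
  rewrite -(big_mkord xpredT (fun i => a' i *: e i)).
  rewrite (big_cat_nat (n := N)) //= [X in _ + X]big_nat [X in _ + X]big1 ?addr0; last first.
    by move=> j /andP[Nj _]; rewrite /a' ltnNge Nj scale0r.
  rewrite -[RHS]aN -(big_mkord xpredT (fun i => a i *: e i)) ; apply: eq_big_nat.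
  by move=> j /andP[_ jN]; rewrite /a' jN.
pose o (_ : nat) : R := 0.
have o0 : (fun m => \sum_(n < m) o n *: e n) @ \oo --> 0.
  apply: cvg_near_cst; near=> m.
  by rewrite big1 // => j _; rewrite scale0r.
by have := congr1 (fun f => f i) (Huniq a' o a'0 o0); rewrite /a' iN.
Unshelve. all: by end_near. Qed.

Lemma vec_inj s t : vec s = vec t -> forall i, s`_i = t`_i.
Proof.
move=> st i; pose N := (size s + size t + i.+1)%N.
have iN : (i < N)%N by rewrite /N addnS ltnS leq_addl.
apply/eqP; rewrite -subr_eq0; apply/eqP.
apply: (@basis_free N (fun i => s`_i - t`_i)) => //.
under eq_bigr do rewrite scalerBl.
by rewrite sumrB -!vec_widen ?st ?subrr // /N; [rewrite -addnA addnCA|rewrite -addnA];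
  rewrite leq_addr.
Qed.

Lemma nonzero_coord x : nonzero x -> exists i, x`_i != 0.
Proof.
move=> x0; apply: contrapT => /forallNP H; case/negP: x0; apply/eqP.
by rewrite /Defs.vec big1 // => i _; have /negP/negPn/eqP-> := H i; rewrite scale0r.
Qed.

Definition lincomb m (b : nat -> R) (x : nat -> seq R) : seq R :=
  mkseq (fun i => \sum_(j < m) b j * (x j)`_i) (\max_(j < m) size (x j)).

Lemma nth_lincomb m b (x : nat -> seq R) i :
  (lincomb m b x)`_i = \sum_(j < m) b j * (x j)`_i.
Proof.
have [iN|Ni] := ltnP i (\max_(j < m) size (x j)); first by rewrite nth_mkseq.
rewrite nth_default ?size_mkseq // big1 // => j _.
by rewrite [(x j)`_i]nth_default ?mulr0 // (leq_trans _ Ni) // (leq_bigmax j).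
Qed.

Lemma vec_lincomb m b (x : nat -> seq R) :
  vec (lincomb m b x) = \sum_(j < m) b j *: vec (x j).
Proof.
rewrite (@vec_widen (\max_(j < m) size (x j))) ?size_mkseq //.
under eq_bigr do rewrite nth_lincomb scaler_suml.
rewrite exchange_big /=; apply: eq_bigr => j _.
rewrite (@vec_widen (\max_(j < m) size (x j))) ?(leq_bigmax j) // scaler_sumr.
by apply: eq_bigr => i _; rewrite scalerA.
Qed.

Lemma inW_lincomb m b (x : nat -> seq R) : (forall j, F (b j)) ->
  (forall j, (j < m)%N -> inW (x j)) -> inW (lincomb m b x).
Proof.
move=> Fb Wx i; rewrite nth_lincomb.
by apply: (@F_sum m (fun j => b j * (x j)`_i)) => j jm; apply: FM => //; apply: Wx.
Qed.

(** The common shape of [in_fspan] and [in_bsub], so that transitivity of spans is proved once. *)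
Definition Fcomb m (v : nat -> V) (w : V) : Prop :=
  exists b : nat -> R, (forall j, F (b j)) /\ w = \sum_(j < m) b j *: v j.

Lemma Fcomb_trans m n (u v : nat -> V) w : Fcomb m v w ->
  (forall j, (j < m)%N -> Fcomb n u (v j)) -> Fcomb n u w.
Proof.
move=> [b [Fb ->]] Hv.
have /choice[c Hc] : forall j, exists c : nat -> R, (j < m)%N ->
    (forall i, F (c i)) /\ v j = \sum_(i < n) c i *: u i.
  move=> j; have [jm|_] := ltnP j m; last by exists (fun=> 0).
  by have [c Hc] := Hv _ jm; exists c.
exists (fun i => \sum_(j < m) b j * c j i); split=> [i|].
  by apply: (@F_sum m (fun j => b j * c j i)) => j jm; apply: FM => //; case: (Hc _ jm) => + _; apply.
under [RHS]eq_bigr do rewrite scaler_suml.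
rewrite exchange_big /=; apply: eq_bigr => j _.
have [_ ->] := Hc j (ltn_ord j); rewrite scaler_sumr.
by apply: eq_bigr => i _; rewrite scalerA.
Qed.

Lemma Fcomb_gen m v j : (j < m)%N -> Fcomb m v (v j).
Proof.
move=> jm; exists (fun i => (i == j)%:R); split=> [i|]; first by case: (i == j).
rewrite (bigD1 (Ordinal jm)) //= eqxx scale1r big1 ?addr0 // => i ij.
by rewrite -val_eqE /= in ij; rewrite (negPf ij) scale0r.
Qed.

Lemma Fcomb_widen m n v w : (m <= n)%N -> Fcomb m v w -> Fcomb n v w.
Proof.
move=> mn vw; apply: Fcomb_trans vw _ => j jm.
exact: Fcomb_gen (leq_trans jm mn).
Qed.

Lemma Fcomb_bsub y m v x : inW x -> Fcomb m v (vec x) ->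
  (forall j, (j < m)%N -> exists2 z, v j = vec z & in_bsub y z) -> in_bsub y x.
Proof.
move=> Wx vx Hv.
have /choice[N HN] : forall j, exists N, (j < m)%N -> Fcomb N (vec \o y) (v j).
  move=> j; have [jm|_] := ltnP j m; last by exists 0%N.
  by have [z -> [_ [N HN]]] := Hv _ jm; exists N.
split=> //; exists (\max_(j < m) N j)%N.
apply: (@Fcomb_trans m _ (vec \o y) v) vx _ => j jm.
by apply: Fcomb_widen (HN j jm); rewrite (leq_bigmax (Ordinal jm)).
Qed.

Lemma in_bsub_gen y n : inW (y n) -> in_bsub y (y n).
Proof. by move=> Wy; split=> //; exists n.+1; apply: (@Fcomb_gen n.+1 (fun j => vec (y j))). Qed.

Lemma in_fspan_bsub y gs x : (forall g, g \in gs -> in_bsub y g) ->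
  in_fspan gs x -> in_bsub y x.
Proof.
move=> Hg [Wx Hx]; apply: Fcomb_bsub Wx Hx _ => j jm.
by exists (nth [::] gs j) => //; apply: Hg; apply: mem_nth.
Qed.

Lemma bsub_incl_gen X y : (forall n, in_bsub X (y n)) -> bsub_incl e F y X.
Proof.
move=> Hy x [Wx [m Hx]]; apply: Fcomb_bsub Wx Hx _ => j _.
by exists (y j).
Qed.

Lemma in_fspan_catl gs hs x : in_fspan gs x -> in_fspan (gs ++ hs) x.
Proof.
move=> [Wx Hx]; split=> //.
apply: (@Fcomb_trans _ _ (fun j => vec (nth [::] (gs ++ hs) j)) (fun j => vec (nth [::] gs j)) _ Hx) => j jm.
have jm' : (j < size (gs ++ hs))%N by rewrite size_cat ltn_addr.
have := Fcomb_gen (fun j => vec (nth [::] (gs ++ hs) j)) jm'.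
by rewrite /= [X in vec X]nth_cat jm.
Qed.

Lemma in_fspan_lincomb gs m b (x : nat -> seq R) : (forall j, F (b j)) ->
  (forall j, (j < m)%N -> in_fspan gs (x j)) -> in_fspan gs (lincomb m b x).
Proof.
move=> Fb Hx; split; first by apply: inW_lincomb => // j /Hx[].
apply: (@Fcomb_trans m (size gs) (fun j => vec (nth [::] gs j)) (fun j => vec (x j))) => [|j /Hx[]//].
by exists b; split; last exact: vec_lincomb.
Qed.

(** * Tails of block sequences, almost inclusion and fusion *)

Definition vanishes_below n x : Prop := forall i, (i < n)%N -> x`_i = 0.

Lemma vanishes_below_le m n x : (m <= n)%N -> vanishes_below n x -> vanishes_below m x.
Proof. by move=> mn Hx i im; apply: Hx; apply: leq_trans mn. Qed.

Definition tail_seq k y n : seq R := y (k + n)%N.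

Lemma block_seq_tail k y : block_seq y -> block_seq (tail_seq k y).
Proof. by move=> By n; rewrite /tail_seq addnS; apply: By. Qed.

Lemma tail_incl k y : block_seq y -> bsub_incl e F (tail_seq k y) y.
Proof. by move=> By; apply: bsub_incl_gen => n; apply: in_bsub_gen; case: (By (k + n)%N). Qed.

Lemma block_seq_blt y m n : block_seq y -> (m < n)%N -> blt (y m) (y n).
Proof.
move=> By; elim: n => // n IH; rewrite ltnS leq_eqVlt => /orP[/eqP->|mn].
  by case: (By n).
move=> i j yi yj; have [_ /nonzero_coord[k yk] /(_ k j yk yj)] := By n.
exact: ltn_trans (IH mn i k yi yk).
Qed.

Lemma block_seq_vanishes y n : block_seq y -> vanishes_below n (y n).
Proof.
move=> By i; elim: n i => // n IH i; rewrite ltnS => ni.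
apply/eqP; apply: contraT => yi.
have [_ /nonzero_coord[k yk] /(_ k i yk yi) ki] := By n.
by rewrite (IH k (leq_trans ki ni)) eqxx in yk.
Qed.

Lemma vec_comb_coord y m (b : nat -> R) x i : vec x = \sum_(j < m) b j *: vec (y j) ->
  x`_i = \sum_(j < m) b j * (y j)`_i.
Proof. by move=> xb; rewrite -(nth_lincomb m b y i); apply: vec_inj; rewrite vec_lincomb. Qed.

Lemma tail_vanishes k y x : block_seq y -> in_bsub (tail_seq k y) x -> vanishes_below k x.
Proof.
move=> By [_ [m [b [_ /vec_comb_coord Hx]]]] i ik; rewrite Hx big1 // => j _.
by rewrite (block_seq_vanishes By) ?mulr0 // (leq_trans ik) // leq_addr.
Qed.

(** Blocks have disjoint supports, so the coefficient of [y j] is read off at a coordinate of its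
    support; for [j < k] this coordinate lies below [n], where [x] vanishes. *)
Lemma in_bsub_tail k n y x : block_seq y ->
  (forall j, (j < k)%N -> (size (y j) <= n)%N) ->
  in_bsub y x -> vanishes_below n x -> in_bsub (tail_seq k y) x.
Proof.
move=> By Hn [Wx [m [b [Fb Hx]]]] x0.
have b0 j : (j < k)%N -> (j < m)%N -> b j = 0.
  move=> jk jm; have [_ /nonzero_coord[i yi] _] := By j.
  have ilt : (i < n)%N.
    by rewrite ltnNge; apply: contra yi => ni; rewrite nth_default // (leq_trans (Hn j jk)).
  have := x0 i ilt; rewrite (vec_comb_coord i Hx) (bigD1 (Ordinal jm)) //= big1 ?addr0.
    by move/eqP; rewrite mulf_eq0 (negPf yi) orbF => /eqP.
  move=> j' jj'; apply/eqP; rewrite mulf_eq0; apply/orP; right; apply: contraT => yi'.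
  rewrite -val_eqE /= neq_ltn in jj'; case/orP: jj' => /(block_seq_blt By) H.
    by have := H i i yi' yi; rewrite ltnn.
  by have := H i i yi yi'; rewrite ltnn.
split=> //; exists (m - k)%N, (fun j => b (k + j)%N); split=> [j //|].
rewrite Hx; have [km|mk] := leqP k m; last first.
  have -> : (m - k = 0)%N by apply/eqP; rewrite subn_eq0 ltnW.
  by rewrite big_ord0 big1 // => j _; rewrite b0 ?scale0r // (ltn_trans (ltn_ord j)).
rewrite -(big_mkord xpredT (fun j => b j *: vec (y j))) (big_cat_nat (n := k)) //=.
rewrite [X in X + _]big_nat [X in X + _]big1 ?add0r; last first.
  by move=> j /andP[_ jk]; rewrite b0 ?scale0r // (leq_trans jk).
rewrite -{1}(add0n k) big_addn big_mkord; apply: eq_bigr => j _.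
by rewrite /tail_seq addnC.
Qed.

(** Inclusion up to finitely many coordinates: a diagonal sequence satisfies it for all stages at
    once, and the integers played in the games absorb [m]. *)
Definition almost_incl Z' Z : Prop :=
  exists m, forall x, in_bsub Z' x -> vanishes_below m x -> in_bsub Z x.

Lemma bsub_incl_almost Z' Z : bsub_incl e F Z' Z -> almost_incl Z' Z.
Proof. by move=> ZZ; exists 0%N => x /ZZ. Qed.

Lemma bsub_incl_trans Z2 Z1 Z3 :
  bsub_incl e F Z1 Z2 -> bsub_incl e F Z2 Z3 -> bsub_incl e F Z1 Z3.
Proof. by move=> Z12 Z23 x /Z12/Z23. Qed.

Lemma almost_incl_tail Y Z' Z : block_seq Y -> bsub_incl e F Y Z' -> almost_incl Z' Z ->
  exists k, bsub_incl e F (tail_seq k Y) Z.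
Proof.
move=> BY YZ' [m Hm]; exists m => x Yx; apply: Hm.
  by apply: YZ'; apply: tail_incl Yx.
exact: tail_vanishes Yx.
Qed.

Lemma exists_block_seq : exists X, block_seq X.
Proof.
pose X n : seq R := rcons (nseq n 0) 1.
have XE n i : (X n)`_i = (i == n)%:R.
  rewrite /X nth_rcons size_nseq nth_nseq.
  by case: ltngtP.
exists X => n; split.
- by move=> i; rewrite XE; case: (i == n).
- apply/eqP => X0; have := @vec_inj (X n) [::] _ n.
  rewrite XE eqxx nth_nil X0 {1}/Defs.vec big_ord0 => /(_ erefl) /eqP.
  by rewrite oner_eq0.
- by move=> i j; rewrite !XE; case: (i =P n) => [->|_]; case: (j =P n.+1) => [->|_]; rewrite ?eqxx.
Qed.

(* Each [Q i] is decided at a stage of a decreasing sequence of block subspaces; the diagonal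
   sequence is almost contained in all the stages, so it inherits all the decisions. *)
Lemma fusion (T : countType) (Q : T -> (nat -> seq R) -> Prop) X0 : block_seq X0 ->
  (forall i Z' Z, block_seq Z' -> block_seq Z -> almost_incl Z' Z -> Q i Z -> Q i Z') ->
  exists X, [/\ block_seq X, bsub_incl e F X X0 &
    forall i, Q i X \/ forall Z, block_seq Z -> bsub_incl e F Z X -> ~ Q i Z].
Proof.
move=> B0 Qmono.
(* Numbers that code nothing get a trivial property. *)
pose Qn n Z := if (unpickle n : option T) is Some i then Q i Z else True.
pose blk := {X : nat -> seq R | block_seq X}.
have step n (X : blk) : exists X' : blk, bsub_incl e F (sval X') (sval X) /\
    (Qn n (sval X') \/ forall Z, block_seq Z -> bsub_incl e F Z (sval X') -> ~ Qn n Z).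
  have [[X' [BX' XX' QX']]|H] := pselect (exists X', [/\ block_seq X', bsub_incl e F X' (sval X) & Qn n X']).
    by exists (exist _ X' BX'); split; [|left].
  exists X; split=> // ; right=> Z BZ ZX QZ; apply: H.
  by exists Z.
have /choice[g Hg] : forall p : nat * blk, exists X' : blk, bsub_incl e F (sval X') (sval p.2) /\
    (Qn p.1 (sval X') \/ forall Z, block_seq Z -> bsub_incl e F Z (sval X') -> ~ Qn p.1 Z).
  by move=> [n X]; apply: step.
pose S := fix S n := if n is n'.+1 then g (n', S n') else exist _ X0 B0 : blk.
have BS n : block_seq (sval (S n)) := svalP (S n).
have S_incl k n : (k <= n)%N -> bsub_incl e F (sval (S n)) (sval (S k)).
  elim: n => [|n IH]; first by rewrite leqn0 => /eqP->.
  rewrite leq_eqVlt => /orP[/eqP->//|]; rewrite ltnS => /IH.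
  by apply: bsub_incl_trans; case: (Hg (n, S n)).
(* The term of index [s] of a block sequence vanishes below [s]; with [s] the size of the previous
   vector, the next one starts after it. *)
pose X := fix X n := if n is n'.+1 then sval (S n) (size (X n')) else sval (S 0%N) 0%N.
have X_S n : exists j, X n = sval (S n) j by case: n => [|n]; eexists.
have X_in k n : (k <= n)%N -> in_bsub (sval (S k)) (X n).
  move=> kn; apply: (S_incl k n kn); have [j ->] := X_S n.
  by apply: in_bsub_gen; case: (BS n j).
have BX : block_seq X.
  move=> n; have [j Xj] := X_S n; have [WX X0' _] := BS n j.
  rewrite -Xj in WX X0'; split=> // i i' Xi Xi'.
  rewrite ltnNge; apply/negP => ii'; case/negP: Xi'; apply/eqP.
  rewrite (block_seq_vanishes (BS n.+1)) // (leq_ltn_trans ii') //.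
  by rewrite ltnNge; apply: contra Xi => Hi; rewrite nth_default.
(* Only the first [k] vectors of [X] may lie outside stage [k]; the bound passes their supports. *)
have XS k : almost_incl X (sval (S k)).
  exists (\max_(j < k) size (X j)) => x Xx x0.
  have : in_bsub (tail_seq k X) x.
    apply: in_bsub_tail Xx x0 => // j jk; exact: (leq_bigmax (Ordinal jk)).
  apply: (bsub_incl_gen (y := tail_seq k X)) => n; apply: X_in; exact: leq_addr.
exists X; split=> //; first by apply: bsub_incl_gen => n; apply: (X_in 0%N).
move=> i; have [_] := Hg (pickle i, S (pickle i)).
rewrite /= -/(S (pickle i).+1) => H.
have QE Z : Qn (pickle i) Z = Q i Z by rewrite /Qn pickleK.
case: H => [|H]; rewrite ?QE; first by left; apply: Qmono (XS (pickle i).+1) _.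
(* [Z] need not lie in the stage that decided [i], but one of its tails does, and [Q] passes to
   tails. *)
right=> Z BZ ZX QZ; have [k Hk] := almost_incl_tail BZ ZX (XS (pickle i).+1).
case: (H (tail_seq k Z) (block_seq_tail k BZ) Hk); rewrite QE.
by apply: Qmono QZ => //; [apply: block_seq_tail|apply/bsub_incl_almost/tail_incl].
Qed.

(** * Equivalence of finite sequences of vectors *)

Local Notation equivK := (equivK e).
Local Notation bsub_incl := (bsub_incl e F).

Lemma equivK_le K K' xs ys : 1 <= K -> K <= K' -> equivK K xs ys -> equivK K' xs ys.
Proof.
move=> K1 KK' [sxy H]; split=> // a; have [H1 H2] := H a; split.
  apply: le_trans H1; apply: ler_wpM2r => //.
  by rewrite lef_pV2 // posrE (lt_le_trans ltr01) // (le_trans K1).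
by apply: le_trans H2 _; apply: ler_wpM2r.
Qed.

Lemma equivK_trans K xs ws zs : 1 <= K ->
  equivK K xs ws -> equivK K ws zs -> equivK (K * K) xs zs.
Proof.
move=> K1 [sxw H] [swz H']; have K0 : 0 <= K by apply: le_trans K1.
split=> [|a]; first by rewrite sxw.
have [H1 H2] := H a; have [H'1 H'2] := H' a; split.
  apply: le_trans H'1; rewrite invfM -mulrA.
  by apply: ler_wpM2l => //; rewrite invr_ge0.
by apply: le_trans H'2 _; rewrite -mulrA; apply: ler_wpM2l.
Qed.

Lemma sum_vanish m n (b : nat -> R) (v : nat -> V) : (m <= n)%N ->
  (forall i, (m <= i)%N -> b i = 0) ->
  \sum_(i < n) b i *: v i = \sum_(i < m) b i *: v i.
Proof.
move=> mn b0; rewrite -!(big_mkord xpredT (fun i => b i *: v i)).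
rewrite (big_cat_nat (n := m) (p := n)) //= [X in _ + X]big_nat [X in _ + X]big1 ?addr0 //.
by move=> i /andP[mi _]; rewrite b0 ?scale0r.
Qed.

Lemma equivK_rcons K xs x ys z : size xs = size ys ->
  equivK K (rcons xs x) (rcons ys z) -> equivK K xs ys.
Proof.
move=> sxy [_ H]; split=> // a.
(* The last vectors get coefficient 0. *)
pose a' i := if (i < size xs)%N then a i else 0.
have E us u : size us = size xs ->
    \sum_(i < size (rcons us u)) a' i *: vec (nth [::] (rcons us u) i) =
    \sum_(i < size us) a i *: vec (nth [::] us i).
  move=> sus; rewrite size_rcons big_ord_recr /= {2}/a' sus ltnn scale0r addr0.
  by apply: eq_bigr => i _; rewrite /a' nth_rcons sus ltn_ord.
by have := H a'; rewrite !E.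
Qed.

(** One matrix [b] expresses [xs] by [v] and [ys] by [w], so equal combinations of [xs] and [ys]
    have equal coefficients on [v] and [w]. *)
Lemma equivK_comb K m (v w : nat -> seq R) (b : nat -> nat -> R) xs ys :
  size xs = size ys ->
  (forall a : nat -> R, K^-1 * `|\sum_(i < m) a i *: vec (v i)| <= `|\sum_(i < m) a i *: vec (w i)| /\
    `|\sum_(i < m) a i *: vec (w i)| <= K * `|\sum_(i < m) a i *: vec (v i)|) ->
  (forall j, (j < size xs)%N -> vec (nth [::] xs j) = \sum_(i < m) b j i *: vec (v i)) ->
  (forall j, (j < size ys)%N -> vec (nth [::] ys j) = \sum_(i < m) b j i *: vec (w i)) ->
  equivK K xs ys.
Proof.
move=> sxy H Hx Hy; split=> // a.
have E (us : seq (seq R)) u :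
    (forall j, (j < size us)%N -> vec (nth [::] us j) = \sum_(i < m) b j i *: vec (u i)) ->
    \sum_(j < size us) a j *: vec (nth [::] us j) =
    \sum_(i < m) (\sum_(j < size us) a j * b j i) *: vec (u i).
  move=> Hu; under [RHS]eq_bigr do rewrite scaler_suml.
  rewrite exchange_big; apply: eq_bigr => j _ /=; rewrite Hu // scaler_sumr.
  by apply: eq_bigr => i _; rewrite scalerA.
by rewrite (E xs v Hx) (E ys w Hy) -sxy; apply: (H (fun i => \sum_(j < size xs) a j * b j i)).
Qed.

(** * The asymptotic and the adversarial game *)

Local Notation F_move := (int * Ord * (seq (seq R) * seq R))%type.
Local Notation G_move := ((nat -> seq R) * Ord * (seq (seq R) * seq R))%type.

(* I plays an ordinal, a vector [z] of [y] and an integer [n]; II answers in [Z] beyond [n]. *)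
Inductive asymptotic_win K Z y (fs zs xs : seq (seq R)) (gamma : Ord) : Prop :=
| asymptotic_over of ozero gamma & equivK K xs zs
| asymptotic_step of ~ ozero gamma & (forall xi z n, olt xi gamma -> in_bsub y z -> nonzero z ->
    exists Fl x, [/\ forall g, g \in Fl -> in_bsub Z g /\ vanishes_below n g,
      nonzero x, in_fspan (fs ++ Fl) x &
      asymptotic_win K Z y (fs ++ Fl) (rcons zs z) (rcons xs x) xi]).

Lemma asymptotic_win_mono K Z' Z y' y fs zs xs gamma :
  almost_incl Z' Z -> bsub_incl y y' ->
  asymptotic_win K Z' y' fs zs xs gamma -> asymptotic_win K Z y fs zs xs gamma.
Proof.
move=> [m ZZ] yy; elim/(well_founded_ind olt_wf): gamma fs zs xs => gamma IH fs zs xs.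
case=> [g0 H|g0 H]; first exact: asymptotic_over.
apply: asymptotic_step => // xi z n xig yz z0.
(* Beyond [m] the answers of II in [Z'] fall into [Z]. *)
have [Fl [x [HFl x0 fx W]]] := H xi z (maxn m n) xig (yy _ yz) z0.
exists Fl, x; split=> //; last exact: IH.
move=> g /HFl[Zg gmn]; split; first apply: ZZ => //.
  exact: vanishes_below_le (leq_maxl m n) gmn.
exact: vanishes_below_le (leq_maxr m n) gmn.
Qed.

(* II plays an integer [n]; I plays an ordinal, [E] in [Z] beyond [n], a vector [z] of the span
   of his finite-dimensional spaces and a subspace [Y]; II answers in [Y]. *)
Inductive adversarial_win K Z (es fs zs xs : seq (seq R)) (gamma : Ord) : Prop :=
| adversarial_over of ozero gamma & equivK K xs zs
| adversarial_step n of ~ ozero gamma & (forall xi E z Y, olt xi gamma ->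
    (forall g, g \in E -> in_bsub Z g /\ vanishes_below n g) ->
    nonzero z -> in_fspan (es ++ E) z -> block_seq Y -> bsub_incl Y Z ->
    exists Fl x, [/\ forall g, g \in Fl -> in_bsub Y g,
      nonzero x, in_fspan (fs ++ Fl) x &
      adversarial_win K Z (es ++ E) (fs ++ Fl) (rcons zs z) (rcons xs x) xi]).

Lemma adversarial_win_mono K Z' Z es fs zs xs gamma : almost_incl Z' Z ->
  adversarial_win K Z es fs zs xs gamma -> adversarial_win K Z' es fs zs xs gamma.
Proof.
move=> ZZ'; have [m ZZ] := ZZ'.
elim/(well_founded_ind olt_wf): gamma es fs zs xs => gamma IH es fs zs xs.
case=> [g0 H|n g0 H]; first exact: adversarial_over.
(* This integer forces the spaces [E] of I into [Z]; his subspace [Y] is replaced by a tail that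
   lies in [Z]. *)
apply: (@adversarial_step _ _ _ _ _ _ _ (maxn m n)) => // xi E z Y xig HE z0 Ez BY YZ.
have [k Hk] := almost_incl_tail BY YZ ZZ'.
have [|Fl [x [HFl x0 fx W]]] := H xi E z _ xig _ z0 Ez (block_seq_tail k BY) Hk.
  move=> g /HE[Zg gmn]; split; first apply: ZZ => //.
    exact: vanishes_below_le (leq_maxl m n) gmn.
  exact: vanishes_below_le (leq_maxr m n) gmn.
exists Fl, x; split=> //; last exact: IH.
by move=> g /HFl; apply: tail_incl.
Qed.

(** Codes reach ordinals only up to equivalence of trees. *)
Lemma adversarial_win_eqv K Z es fs zs xs gamma gamma' :
  ole gamma gamma' -> ole gamma' gamma ->
  adversarial_win K Z es fs zs xs gamma -> adversarial_win K Z es fs zs xs gamma'.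
Proof.
move=> gg' g'g [g0 H|n g0 H]; first by apply: adversarial_over => //; apply: ole_trans g'g g0.
apply: (@adversarial_step _ _ _ _ _ _ _ n) => [g'0|xi E z Y xig].
  by apply: g0; apply: ole_trans gg' g'0.
by apply: H; apply: olt_ole_trans xig g'g.
Qed.

(** * From a win of II in F to a win in the asymptotic game *)

Section Simulation.
Variables (K : R) (X y : nat -> seq R) (gamma : Ord).
Hypothesis K1 : 1 <= K.
Let wins := @II_wins_from R (int * Ord) (seq (seq R) * seq R) (fun a => a.2) (fun b => b.2)
  (@F_legalI R) (F_legalII e F X) gamma (fun xs => equivK K xs (mkseq y (size xs))).
Let clock (h : seq F_move) := prev_clock (fun a : int * Ord => a.2) gamma h.
Let outs (h : seq F_move) := outcome (fun b : seq (seq R) * seq R => b.2) h.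
Let gens (h : seq F_move) := gens_so_far h [::].

(** I can end the game in one more round by playing the ordinal 0. The final outcome is then
    equivalent to its segment of [y], and dropping the last vector preserves this. *)
Lemma F_win_prefix h : wins h -> equivK K (outs h) (mkseq y (size (outs h))).
Proof.
case=> [//|nO H].
have [|b [_ W]] := H (0, OZ); first by split=> //; apply: nzero_olt.
have : equivK K (outs (rcons h ((0, OZ), b))) (mkseq y (size (outs (rcons h ((0, OZ), b))))).
  case: W => [//|[]]; rewrite /game_over /prev_clock map_rcons last_rcons.
  exact: ole_refl.
rewrite /outs /outcome map_rcons size_rcons mkseqS.
by apply: equivK_rcons; rewrite size_mkseq.
Qed.

Lemma F_win_extend n d c h :
  wins h -> (forall x, x \in outs h -> in_fspan (gens h) x) -> ole (oaddn c d) (clock h) ->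
  exists h' Fl xs, [/\ wins h', forall x, x \in outs h' -> in_fspan (gens h') x,
    ole c (clock h'), gens h' = gens h ++ Fl &
    [/\ outs h' = outs h ++ xs, size xs = d &
      forall g, g \in Fl -> in_bsub X g /\ vanishes_below n g]].
Proof.
elim: d h => [|d IH] h W Hh Hc /=.
  by exists h, [::], [::]; rewrite !cats0; split.
have [g0|nO H] := W; first by case: (olt_nzero Hc).
have [|[Fl x] [[HFl [_ fx]] W']] := H (n%:Z, oaddn c d); first by [].
set r := ((n%:Z, oaddn c d), (Fl, x)) in W'.
have gE : gens (rcons h r) = gens h ++ Fl.
  by rewrite /gens /gens_so_far map_rcons flatten_rcons !cats0.
have oE : outs (rcons h r) = rcons (outs h) x by rewrite /outs /outcome map_rcons.
have [| |h' [Fl' [xs [Wh' Hh' ch' gh' [oh' sxs HFl']]]]] := IH _ W'.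
- move=> x'; rewrite oE gE mem_rcons inE => /orP[/eqP->|/Hh]; last exact: in_fspan_catl.
  by move: fx; rewrite /gens_so_far /= /gens /gens_so_far cats0.
- by rewrite /clock /prev_clock map_rcons last_rcons; apply: ole_refl.
exists h', (Fl ++ Fl'), (x :: xs); split=> //; first by rewrite gh' gE catA.
split=> [||g]; first by rewrite oh' oE cat_rcons.
  by rewrite /= sxs.
rewrite mem_cat => /orP[/HFl[Xg Hg]|/HFl'//]; split=> // i ni.
by apply: Hg; rewrite lez_nat ltnW.
Qed.

(* A vector [\sum_(i < m) b i *: y i] played by I is answered by the same combination of
   the answers to [y 0, ..., y m.-1], obtained in finitely many rounds: hence the factor omega. *)
Lemma F_win_asymptotic K' beta h fs zs xs (b : nat -> nat -> R) : K <= K' ->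
  wins h -> (forall x, x \in outs h -> in_fspan (gens h) x) ->
  ole (omul_omega beta) (clock h) -> gens h = fs -> size zs = size xs ->
  (forall j i, (size (outs h) <= i)%N -> b j i = 0) ->
  (forall j, (j < size zs)%N -> vec (nth [::] zs j) = \sum_(i < size (outs h)) b j i *: vec (y i)) ->
  (forall j, (j < size xs)%N -> vec (nth [::] xs j) =
     \sum_(i < size (outs h)) b j i *: vec (nth [::] (outs h) i)) ->
  asymptotic_win K' X y fs zs xs beta.
Proof.
move=> KK'; elim/(well_founded_ind olt_wf): beta h fs zs xs b.
move=> beta IH h fs zs xs b W Hh Hc fsE szx b0 Hz Hx.
have [z0|nz] := pselect (ozero beta).
  apply: asymptotic_over => //; apply: equivK_le K1 KK' _.
  apply: (@equivK_comb K (size (outs h)) (nth [::] (outs h)) y b) => // a.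
  have [_ /(_ a)] := F_win_prefix W; rewrite size_mkseq.
  rewrite [in X in _ * _ <= X](eq_bigr (fun i : 'I__ => a i *: vec (y i))); last first.
    by move=> i _; rewrite nth_mkseq.
  by rewrite [in X in X <= K * _](eq_bigr (fun i : 'I__ => a i *: vec (y i))) // => i _; rewrite nth_mkseq.
apply: asymptotic_step => // xi z n xib [Wz [M [c [Fc zE]]]] zn0.
(* [M] more rounds answer at least [y 0], ..., [y M.-1], and leave omega * xi on the clock. *)
have [h' [Fl [us [W' Hh' Hc' gE [oE sus HFl]]]]] :=
  F_win_extend n W Hh (ole_trans (omul_omega_olt M xib) Hc).
pose c' j := if (j < M)%N then c j else 0.
have Fc' j : F (c' j) by rewrite /c'; case: ifP.
have zE' : vec z = \sum_(j < size (outs h')) c' j *: vec (y j).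
  rewrite (@sum_vanish M _ c' (fun j => vec (y j))) ?oE ?size_cat ?sus ?leq_addl //.
    by rewrite zE; apply: eq_bigr => j _; rewrite /c' ltn_ord.
  by move=> j Mj; rewrite /c' ltnNge Mj.
pose x := lincomb (size (outs h')) c' (nth [::] (outs h')).
have fx : in_fspan (fs ++ Fl) x.
  by rewrite -fsE -gE; apply: in_fspan_lincomb => // j jm; apply: Hh'; apply: mem_nth.
have xE : vec x = \sum_(i < size (outs h')) c' i *: vec (nth [::] (outs h') i).
  exact: vec_lincomb.
exists Fl, x; split=> //.
  (* [x] and [z] have the same coefficients [c'], so equivalence bounds the norm of [z] by [K] times
     that of [x]. *)
  apply/negP => /eqP x0; case/negP: zn0; rewrite -normr_le0.
  have [_ /(_ c')] := F_win_prefix W'; rewrite -xE x0 normr0 !mulr0 size_mkseq => -[_ zx].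
  rewrite zE'; apply: le_trans zx; rewrite le_eqVlt; apply/orP; left; apply/eqP; congr (`| _ |).
  by apply: eq_bigr => i _; rewrite nth_mkseq.
(* The matrix gains the row [c'] for the new pair [z], [x]. *)
pose b' j := if (j < size zs)%N then b j else c'.
have ss' : (size (outs h) <= size (outs h'))%N by rewrite oE size_cat leq_addr.
apply: (IH xi xib h' _ _ _ b') => //.
- by rewrite gE fsE.
- by rewrite !size_rcons szx.
- move=> j i hi; rewrite /b'; case: ifP => _; first by apply: b0; apply: leq_trans ss' hi.
  by rewrite /c' ltnNge (leq_trans _ hi) // oE size_cat sus leq_addl.
- move=> j; rewrite size_rcons ltnS nth_rcons /b'; case: ltngtP => // jz _.
  by rewrite (sum_vanish (fun j => vec (y j)) ss') ?Hz // => i; apply: b0.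
- move=> j; rewrite size_rcons ltnS nth_rcons /b' -szx; case: ltngtP => // jz _.
  rewrite (sum_vanish (fun i => vec (nth [::] (outs h') i)) ss') ?Hx -?szx //; last by move=> i; apply: b0.
  by apply: eq_bigr => i _; rewrite oE nth_cat ltn_ord.
Qed.

End Simulation.

(** * From the asymptotic to the adversarial game, and their composition *)

Definition allW (ss : seq (seq R)) : Prop := forall s, s \in ss -> inW s.

Lemma allW_cat ss ts : allW ss -> allW ts -> allW (ss ++ ts).
Proof. by move=> Ws Wt s; rewrite mem_cat => /orP[/Ws|/Wt]. Qed.

Lemma allW_rcons ss s : allW ss -> inW s -> allW (rcons ss s).
Proof. by move=> Ws Wt t; rewrite mem_rcons inE => /orP[/eqP->|/Ws]. Qed.

(* Proved downwards on [gamma]: if II did not win the adversarial game on [X1], then by [X1_dec]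
   he would not win it on [y], so I has a good move there, which [X_dec] makes a good move for I
   against all the answers of II in a tail of [X]. *)
Lemma asymptotic_adversarial K X1 X y alpha :
  block_seq y -> bsub_incl y X -> bsub_incl X X1 ->
  (forall es fs zs xs gamma, allW es -> allW fs -> allW zs -> allW xs -> ole gamma alpha ->
    adversarial_win K X1 es fs zs xs gamma \/
    forall Z, block_seq Z -> bsub_incl Z X1 -> ~ adversarial_win K Z es fs zs xs gamma) ->
  (forall es fs zs xs gamma Z, allW es -> allW fs -> allW zs -> allW xs -> ole gamma alpha ->
    block_seq Z -> bsub_incl Z X ->
    (forall Fl x, (forall g, g \in Fl -> in_bsub Z g) -> nonzero x -> in_fspan (fs ++ Fl) x ->
       ~ adversarial_win K X1 es (fs ++ Fl) zs (rcons xs x) gamma) ->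
    exists n, forall Fl x, (forall g, g \in Fl -> in_bsub X g /\ vanishes_below n g) ->
      nonzero x -> in_fspan (fs ++ Fl) x ->
      ~ adversarial_win K X1 es (fs ++ Fl) zs (rcons xs x) gamma) ->
  forall gamma es fs zs xs, allW es -> allW fs -> allW zs -> allW xs -> ole gamma alpha ->
    (forall g, g \in es -> in_bsub y g) ->
    asymptotic_win K X y fs zs xs gamma -> adversarial_win K X1 es fs zs xs gamma.
Proof.
move=> By yX XX1 X1_dec X_dec gamma; have yX1 := bsub_incl_trans yX XX1.
elim/(well_founded_ind olt_wf): gamma => gamma IH es fs zs xs Wes Wfs Wzs Wxs ga ey.
case=> [g0 H|g0 H]; first exact: adversarial_over.
apply: contrapT => nW.
have [//|/(_ y By yX1) nWy] := X1_dec _ _ _ _ _ Wes Wfs Wzs Wxs ga.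
(* Let II play 0 on [y]: as he does not win, some move of I has no good answer in [Y]. *)
apply: nWy; apply: (@adversarial_step _ _ _ _ _ _ _ 0%N) => // xi E z Y xig HE z0 Ez BY Yy.
apply: contrapT => nA.
have WE : allW E by move=> g /HE[[]].
have Wz : inW z by case: Ez.
have xia := ole_trans (olt_ole xig) ga.
have YX := bsub_incl_trans Yy yX.
have [|n Hn] := X_dec (es ++ E) fs (rcons zs z) xs xi Y (allW_cat Wes WE) Wfs
    (allW_rcons Wzs Wz) Wxs xia BY YX.
  move=> Fl x HFl x0 fx W; apply: nA; exists Fl, x; split=> //.
  exact: adversarial_win_mono (bsub_incl_almost yX1) W.
have eEy g : g \in es ++ E -> in_bsub y g by rewrite mem_cat => /orP[/ey|/HE[]].
(* I may play [z] in the asymptotic game, as his spaces stayed in [y]. By induction the answer of II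
   beyond [n] is good, which [Hn] forbids. *)
have [Fl [x [HFl x0 fx W]]] := H xi z n xig (in_fspan_bsub eEy Ez) z0.
apply: (Hn Fl x) => //; apply: IH => //.
- exact: allW_cat.
- by apply: allW_cat => // g /HFl[[]].
- exact: allW_rcons.
- by apply: allW_rcons => //; case: fx.
Qed.

(* In the round of [G], II first answers the vector [z l] by [w] in [X] following the asymptotic
   strategy, then answers [w] in the subspace chosen by I following the adversarial one. *)
Lemma compose_wins K X1 X y z alpha (h : seq G_move) es ws : 1 <= K ->
  bsub_incl y X -> bsub_incl X X1 -> block_seq z -> (forall n, in_bsub y (z n)) ->
  let gamma := prev_clock (fun a : (nat -> seq R) * Ord => a.2) alpha h in
  adversarial_win K X1 es (gens_so_far h [::]) ws (outcome (fun b => b.2) h) gamma ->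
  asymptotic_win K X y es (mkseq z (size h)) ws gamma ->
  II_wins_from (fun a : (nat -> seq R) * Ord => a.2) (fun b : seq (seq R) * seq R => b.2)
    (G_legalI e F y) (G_legalII e F) alpha
    (fun xs => equivK (K * K) xs (mkseq z (size xs))) h.
Proof.
move=> K1 yX XX1 Bz yz gamma.
have : gamma = prev_clock (fun a : (nat -> seq R) * Ord => a.2) alpha h by [].
clearbody gamma.
elim/(well_founded_ind olt_wf): gamma h es ws => gamma IH h es ws gE A C.
have [g0|g0] := pselect (ozero gamma).
  apply: II_wins_over; first by rewrite /game_over -gE.
  rewrite size_map; case: A => [_ A|]//; case: C => [_ C|]//.
  exact: equivK_trans C.
case: A => [//|n _ A]; case: C => [//|_ C].
apply: II_wins_step; first by rewrite /game_over -gE.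
move=> [Y xi] [/= xig [/= BY Yy]]; rewrite -gE in xig.
have zn0 : nonzero (z (size h)) by case: (Bz (size h)).
have [E [w [HE w0 Ew C']]] := C xi (z (size h)) n xig (yz _) zn0.
have [|Fl [x [HFl x0 fx A']]] :=
    A xi E w Y xig _ w0 Ew BY (bsub_incl_trans Yy (bsub_incl_trans yX XX1)).
  by move=> g /HE[Xg gn]; split=> //; apply: XX1.
have gsE : gens_so_far h [::] ++ Fl = gens_so_far h Fl by rewrite /gens_so_far cats0.
exists (Fl, x); split; first by split=> //; split=> //=; rewrite -gsE.
apply: (IH xi xig _ (es ++ E) (rcons ws w)).
- by rewrite /prev_clock map_rcons last_rcons.
- have -> : gens_so_far (rcons h ((Y, xi), (Fl, x))) [::] = gens_so_far h [::] ++ Fl.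
    by rewrite /gens_so_far map_rcons flatten_rcons !cats0.
  by rewrite /outcome map_rcons.
- by rewrite size_rcons mkseqS.
Qed.

(** * Coding of positions, and subspaces that decide them *)

Hypothesis HFc : countable F.

Let decode_F : exists f : nat -> R, forall a, F a -> exists n, f n = a.
Proof.
have /countable_injP[p p_inj] := HFc.
have /choice[f Hf] : forall n, exists a, (exists2 b, F b & p b = n) -> F a /\ p a = n.
  move=> n; have [[b Fb pb]|H] := pselect (exists2 b, F b & p b = n); first by exists b.
  by exists 0 => -[b Fb pb]; case: H; exists b.
exists f => a Fa; exists (p a); have [|Ff pf] := Hf (p a); first by exists a.
by apply: p_inj => //; rewrite inE.
Qed.

Lemma map_surj (T : Type) (U : eqType) (f : T -> U) (us : seq U) :
  (forall u, u \in us -> exists a, f a = u) -> exists ts, map f ts = us.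
Proof.
elim: us => [|u us IH] H; first by exists [::].
have [a au] := H u (mem_head _ _).
have [|ts tss] := IH; first by move=> v vs; apply: H; rewrite inE vs orbT.
by exists (a :: ts); rewrite /= au tss.
Qed.

(** [fusion] needs a [countType] of indices: vectors are coded by the indices of their coordinates
    in an enumeration of [F]. *)
Lemma decode_W : exists f : seq (seq nat) -> seq (seq R),
  forall ss, allW ss -> exists c, f c = ss.
Proof.
have [f Hf] := decode_F; exists (map (map f)) => ss Wss.
apply: map_surj => s /Wss Ws; apply: map_surj => a /(nthP 0)[i _ <-].
exact: Hf (Ws i).
Qed.

(* The ordinals up to [alpha] and the positions are countable up to equivalence, so that
   [fusion] decides all of them at once. *)
Lemma decide (Q : seq (seq R) -> seq (seq R) -> seq (seq R) -> seq (seq R) -> Ord ->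
    (nat -> seq R) -> Prop) alpha X0 : block_seq X0 ->
  (forall es fs zs xs gamma Z' Z, almost_incl Z' Z ->
     Q es fs zs xs gamma Z -> Q es fs zs xs gamma Z') ->
  (forall es fs zs xs gamma gamma' Z, ole gamma gamma' -> ole gamma' gamma ->
     Q es fs zs xs gamma Z -> Q es fs zs xs gamma' Z) ->
  exists X, [/\ block_seq X, bsub_incl X X0 &
    forall es fs zs xs gamma, allW es -> allW fs -> allW zs -> allW xs -> ole gamma alpha ->
      Q es fs zs xs gamma X \/
      forall Z, block_seq Z -> bsub_incl Z X -> ~ Q es fs zs xs gamma Z].
Proof.
move=> B0 Qmono Qeqv; have [f Hf] := decode_W; pose S := seq (seq nat).
have [X [BX XX0 HX]] := @fusion (S * S * S * S * seq nat)%type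
  (fun p Z => Q (f p.1.1.1.1) (f p.1.1.1.2) (f p.1.1.2) (f p.1.2) (subord (OS alpha) p.2) Z)
  X0 B0 (fun p Z' Z _ _ => @Qmono _ _ _ _ _ Z' Z).
exists X; split=> // es fs zs xs gamma /Hf[e1 <-] /Hf[e2 <-] /Hf[e3 <-] /Hf[e4 <-] ga.
(* The ordinals up to [alpha] are those below [OS alpha]. *)
have [c [cg gc]] := subordP (ole_succ ga).
have [/= H|/= H] := HX (e1, e2, e3, e4, c); first by left; apply: Qeqv cg gc H.
by right=> Z BZ ZX QZ; apply: (H Z BZ ZX); apply: Qeqv gc cg QZ.
Qed.

Lemma exists_adversarial_win K alpha X0 : block_seq X0 ->
  (forall Z, block_seq Z -> bsub_incl Z X0 -> exists y, [/\ block_seq y, bsub_incl y Z &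
     asymptotic_win K Z y [::] [::] [::] alpha]) ->
  exists X1 X y, [/\ block_seq y, bsub_incl y X, bsub_incl X X1,
    adversarial_win K X1 [::] [::] [::] [::] alpha &
    asymptotic_win K X y [::] [::] [::] alpha].
Proof.
move=> B0 H.
have [X1 [BX1 X10 X1_dec]] := @decide
  (fun es fs zs xs gamma Z => adversarial_win K Z es fs zs xs gamma) alpha X0 B0
  (fun es fs zs xs gamma Z' Z ZZ' => @adversarial_win_mono K Z' Z es fs zs xs gamma ZZ')
  (fun es fs zs xs gamma gamma' Z => @adversarial_win_eqv K Z es fs zs xs gamma gamma').
(* Here I has moved and II is to answer: [Z] rejects if all answers far enough in [Z] lose on
   [X1]. *)
pose rejects es fs zs xs gamma Z := exists n, forall Fl x,
  (forall g, g \in Fl -> in_bsub Z g /\ vanishes_below n g) -> nonzero x ->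
  in_fspan (fs ++ Fl) x -> ~ adversarial_win K X1 es (fs ++ Fl) zs (rcons xs x) gamma.
have [||X [BX XX1 X_dec]] := @decide rejects alpha X1 BX1.
- move=> es fs zs xs gamma Z' Z [m ZZ'] [n Hn]; exists (maxn m n) => Fl x HFl.
  apply: Hn => g /HFl[Zg gmn]; split; first apply: ZZ' => //.
    exact: vanishes_below_le (leq_maxl m n) gmn.
  exact: vanishes_below_le (leq_maxr m n) gmn.
- move=> es fs zs xs gamma gamma' Z gg' g'g [n Hn]; exists n => Fl x HFl x0 fx W.
  by apply: (Hn Fl x HFl x0 fx); apply: adversarial_win_eqv W.
have [y [By yX W]] := H X BX (bsub_incl_trans XX1 X10).
exists X1, X, y; split=> //.
apply: (asymptotic_adversarial By yX XX1 X1_dec _ _ _ _ _ (ole_refl alpha)) W => //.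
move=> es fs zs xs gamma Z Wes Wfs Wzs Wxs ga BZ ZX HZ.
have [//|nR] := X_dec es fs zs xs gamma Wes Wfs Wzs Wxs ga.
(* If all answers in [Z] lose, [Z] rejects with bound 0, so [X] cannot have been decided
   negatively. *)
case: (nR Z BZ ZX); exists 0%N => Fl x HFl; apply: HZ => g /HFl[].
by [].
Qed.

(** Fusion gives an [X] deciding [no_win k] for every [k]. For the [k] that the hypothesis provides
    in [X], [no_win k] fails there, hence in every block subspace of [X]. *)
Lemma uniform_constant alpha :
  (forall X, block_seq X -> exists y k, [/\ block_seq y, bsub_incl y X &
     asymptotic_win k.+1%:R X y [::] [::] [::] alpha]) ->
  exists X k, block_seq X /\ forall Z, block_seq Z -> bsub_incl Z X ->
    exists y, [/\ block_seq y, bsub_incl y Z & asymptotic_win k.+1%:R Z y [::] [::] [::] alpha].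
Proof.
move=> H; apply: contrapT => nX; have [X0 B0] := exists_block_seq.
pose no_win (k : nat) Z := forall y, block_seq y -> bsub_incl y Z ->
  ~ asymptotic_win k.+1%:R Z y [::] [::] [::] alpha.
have [|X [BX _ HX]] := @fusion _ no_win X0 B0.
  move=> k Z' Z _ _ ZZ' HZ y By yZ' W.
  have [m yZ] := almost_incl_tail By yZ' ZZ'.
  apply: (HZ _ (block_seq_tail m By) yZ).
  exact: asymptotic_win_mono ZZ' (tail_incl By) W.
have [y [k [By yX W]]] := H X BX.
have [/(_ y By yX)//|H'] := HX k.
apply: nX; exists X, k; split=> // Z BZ ZX; apply: contrapT => nZ.
apply: (H' Z BZ ZX) => y' By' yZ' W'; apply: nZ.
by exists y'.
Qed.

End Vectors.


Theorem theorem4p7 (R : realType) (V : completeNormedModType R)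
  (e : nat -> V) (He : schauder_basis e)
  (F : set R) (HFc : countable F) (HFf : is_subfield F)
  (HFn : norm_closed e F) (alpha : Ord) :
  exists X : nat -> seq R, block_seq e F X /\
    ((forall (y : nat -> seq R) (K : R),
        block_seq e F y -> (forall n, in_bsub e F X (y n)) -> 1 <= K ->
        F_game_I e F X (omul_omega alpha)
          (fun xs => ~ equivK e K xs (mkseq y (size xs))))
     \/
     (exists K : R, 1 <= K /\
        forall z : nat -> seq R,
          block_seq e F z -> (forall n, in_bsub e F X (z n)) ->
          G_game_II e F X alpha
            (fun xs => equivK e K xs (mkseq z (size xs))))).
Proof.
apply: contrapT => nX.
have [|X0 [k [B0 H0]]] := @uniform_constant R V e He F HFf alpha.
  move=> X BX; apply: contrapT => nW; apply: nX; exists X; split=> //; left.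
  move=> y K By Xy K1; apply: (II_wins_from_determined (0, OZ)) => W.
  (* Rounding [K] up to an integer leaves countably many constants for the fusion. *)
  apply: nW; exists y, (Num.bound K); split=> //; first exact: (bsub_incl_gen HFf).
  have KB : K <= (Num.bound K).+1%:R.
    by rewrite (le_trans (ltW (archi_boundP (le_trans ler01 K1)))) // ler_nat.
  by apply: (F_win_asymptotic HFf K1 (b := fun _ _ => 0) KB W) => //; apply: ole_refl.
have [X1 [X [y [By yX XX1 A C]]]] := exists_adversarial_win He HFf HFc B0 H0.
have K1 : 1 <= k.+1%:R :> R by rewrite ler1n.
(* The second alternative holds in the span of [y]; each of the two composed games costs a factor
   [k.+1]. *)
apply: nX; exists y; split=> //; right; exists (k.+1%:R * k.+1%:R); split.
  by rewrite -natrM ler1n.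
move=> z Bz yz; apply: (II_wins_from_start ([::], [::])).
exact: (compose_wins (h := [::]) K1 yX XX1 Bz yz A C).
Qed.
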